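(* Let $H$ be a complex separable Hilbert space, let $\mathcal{L}$ be a completely distributive commutative subspace lattice on $H$ (so that $\mathrm{Alg}\mathcal{L}$ is a CDCSL algebra), and let $\delta:\mathrm{Alg}\mathcal{L}\to\mathrm{Alg}\mathcal{L}$ be a bounded linear mapping. Then $\delta$ is Jordan derivable at zero point if and only if $\delta$ is a generalized derivation and $\delta(I)\in(\mathrm{Alg}\mathcal{L})'$. In particular, if $\delta(I)=0$, then $\delta$ is Jordan derivable at zero point if and only if $\delta$ is a derivation.
   Context: $B(H)$ is the algebra of bounded linear operators on $H$. A subspace lattice on $H$ is a collection $\mathcal{L}$ of closed subspaces of $H$ containing $(0)$ and $H$ and closed under arbitrary intersections $\wedge$ and arbitrary closed linear spans $\vee$ (the closed span of an empty family is $(0)$). Closed subspaces are identified with the orthogonal projections onto them. $\mathcal{L}$ is a commutative subspace lattice (CSL) if its projections commute pairwise. For $E\in\mathcal{L}$, $E_-=\vee\{F\in\mathcal{L}:F\nsupseteq E\}$; $\mathcal{L}$ is completely distributive if $L=\vee\{E\in\mathcal{L}:E_-\nsupseteq L\}$ for every $L\in\mathcal{L}$. $\mathrm{Alg}\mathcal{L}$ is the algebra of operators in $B(H)$ leaving every member of $\mathcal{L}$ invariant; $(\mathrm{Alg}\mathcal{L})'$ is its commutant in $B(H)$. A linear mapping $\delta$ on $\mathrm{Alg}\mathcal{L}$ is Jordan derivable at zero point if $\delta(AB+BA)=\delta(A)B+A\delta(B)+\delta(B)A+B\delta(A)$ for all $A,B\in\mathrm{Alg}\mathcal{L}$ with $AB+BA=0$.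 It is a derivation if $\delta(AB)=\delta(A)B+A\delta(B)$ for all $A,B$, and a generalized derivation if $\delta(AB)=\delta(A)B+A\delta(B)-A\delta(I)B$ for all $A,B$. *)

(* Defs.v *)
From HB Require Import structures.
From mathcomp Require Import all_boot all_order all_algebra.
From mathcomp Require Import sesquilinear complex.
From mathcomp Require Import ring lra.
From mathcomp Require Import all_classical all_reals all_analysis.

Set Implicit Arguments.
Unset Strict Implicit.
Unset Printing Implicit Defensive.

Import Order.TTheory GRing.Theory Num.Theory.
Import numFieldNormedType.Exports.

Local Open Scope classical_set_scope.
Local Open Scope ring_scope.

(* The inner product is linear in its first argument. *)
HB.mixin Record CompleteNormedModule_isHilbert (R : realType) H
    of CompleteNormedModule R[i] H := {
  inner : {dot H for (@Num.conj R[i])};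
  inner_norm : forall x : H, inner x x = `|x| ^+ 2
}.

#[short(type="hilbertType")]
HB.structure Definition Hilbert (R : realType) :=
  {H of CompleteNormedModule_isHilbert R H & CompleteNormedModule R[i] H}.

Definition separable (T : topologicalType) :=
  exists2 D : set T, countable D & dense D.

Section BoundedOperators.
Variables (R : realType) (H : hilbertType R).

Definition bounded_operator : pred (H -> H) := fun T =>
  `[< linear T /\ exists M : R[i], forall x, `|T x| <= M * `|x| >].

Fact bounded_operator_submod : submod_closed bounded_operator.
Proof.
split=> [|a S T /asboolP[Sl [M SM]] /asboolP[Tl [N TN]]].
  apply/asboolP; split=> [a x y|]; first by rewrite /GRing.zero/= scaler0 addr0.
  by exists 0 => x; rewrite normr0 mul0r.
apply/asboolP; split=> [b x y|].
  rewrite !fctE Sl Tl !scalerDr !scalerA (mulrC a) -!addrA; congr (_ + _).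
  by rewrite addrCA.
exists (`|a| * M + N) => x; rewrite mulrDl -mulrA !fctE.
by rewrite (le_trans (ler_normD _ _)) ?lerD ?normrZ ?ler_wpM2l.
Qed.
HB.instance Definition _ := GRing.isSubmodClosed.Build R[i] (H -> H)
  bounded_operator (GRing.submod_closed_semi bounded_operator_submod).

Record bop := Bop { bop_fun :> H -> H; _ : bop_fun \in bounded_operator }.
HB.instance Definition _ := [isSub for bop_fun].
HB.instance Definition _ := [Choice of bop by <:].
HB.instance Definition _ := [SubChoice_isSubZmodule of bop by <:].
HB.instance Definition _ := [SubZmodule_isSubLmodule of bop by <:].

Lemma bop_linear (T : bop) : linear T.
Proof. by have /asboolP[] := valP T. Qed.

Lemma bop_bounded (T : bop) :
  exists2 M : R, 0 <= M & forall x, `|T x| <= M%:C%C * `|x|.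
Proof.
have /asboolP[Tl [M TM]] := valP T.
have normM : (complex.Re `|M|)%:C%C = `|M| by rewrite RRe_real ?normr_real.
exists (complex.Re `|M|) => [|x]; first by rewrite -lecR normM normr_ge0.
rewrite normM (le_trans (TM x)) //.
have [->|x0] := eqVneq x 0; first by rewrite normr0 !mulr0.
rewrite ler_wpM2r // real_ler_norm // ger0_real //.
by rewrite -(pmulr_lge0 _ (_ : 0 < `|x|)) ?normr_gt0 // (le_trans _ (TM x)).
Qed.

Lemma bopP (S T : bop) : S =1 T -> S = T.
Proof. by move=> ST; apply/val_inj/funext. Qed.

Fact bop_one_subproof : id \in bounded_operator.
Proof. by apply/asboolP; split=> //; exists 1 => x; rewrite mul1r. Qed.
Definition bop_one := Bop bop_one_subproof.

Fact bop_comp_subproof (S T : bop) : S \o T \in bounded_operator.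
Proof.
apply/asboolP; split=> [a x y|] /=; first by rewrite !bop_linear.
have [[M M0 SM] [N N0 TN]] := (bop_bounded S, bop_bounded T).
exists (M%:C%C * N%:C%C) => x /=; rewrite (le_trans (SM _)) // -mulrA.
by rewrite ler_wpM2l // (lecR 0).
Qed.
Definition bop_comp (S T : bop) := Bop (bop_comp_subproof S T).

Fact bop_compA : associative bop_comp. Proof. by move=> *; exact: bopP. Qed.
Fact bop_comp1l : left_id bop_one bop_comp.
Proof. by move=> *; exact: bopP. Qed.
Fact bop_comp1r : right_id bop_one bop_comp.
Proof. by move=> *; exact: bopP. Qed.
Fact bop_compDl : left_distributive bop_comp +%R.
Proof. by move=> *; exact: bopP. Qed.
Fact bop_compDr : right_distributive bop_comp +%R.
Proof.
move=> S T U; apply: bopP => x /=.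
by have := bop_linear S 1 (T x) (U x); rewrite !scale1r.
Qed.
HB.instance Definition _ := GRing.Zmodule_isPzRing.Build bop
  bop_compA bop_comp1l bop_comp1r bop_compDl bop_compDr.

Definition opnorm (T : bop) : R :=
  sup [set complex.Re `|T x| | x in [set x : H | `|x| <= 1]].

Lemma opnormP (T : bop) x : `|T x| <= (opnorm T)%:C%C * `|x|.
Proof.
have TZ (a : R[i]) y : T (a *: y) = a *: T y.
  have T0 : T 0 = 0.
    by have := bop_linear T (-1) 0 0; rewrite !scaler0 addr0 scaleN1r addNr.
  by have := bop_linear T a y 0; rewrite T0 !addr0.
have [->|x0] := eqVneq x 0.
  by have := TZ 0 0; rewrite !scale0r => ->; rewrite !normr0 mulr0.
have nx0 : 0 < `|x| by rewrite normr_gt0.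
have [M M0 TM] := bop_bounded T.
pose y := `|x|^-1 *: x; have y1 : `|y| = 1.
  by rewrite normrZ normfV normr_id mulVf // gt_eqF.
have Ty : `|T x| / `|x| = `|T y| by rewrite TZ normrZ normfV normr_id mulrC.
rewrite -ler_pdivrMr // Ty.
have -> : `|T y| = (complex.Re `|T y|)%:C%C by rewrite RRe_real ?normr_real.
rewrite lecR; apply: ub_le_sup; last by exists y => //=; rewrite y1.
exists M => _ [z /= z1 <-]; rewrite -lecR RRe_real ?normr_real //.
by rewrite (le_trans (TM z)) // ler_piMr // (lecR 0).
Qed.

Definition commutant (S : set bop) : set bop :=
  [set T | forall A, S A -> T * A = A * T].

End BoundedOperators.

Section SubspaceLattices.
Variables (R : realType) (H : hilbertType R).
Implicit Types (E F : set H).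

Definition closed_subspace E :=
  [/\ E 0, forall (a : R[i]) x y, E x -> E y -> E (a *: x + y) & closed E].

Definition linear_span (A : set H) : set H :=
  [set x | exists (n : nat) (c : 'I_n -> R[i]) (v : 'I_n -> H),
     (forall i, A (v i)) /\ x = \sum_i c i *: v i].

Definition join (P : set (set H)) : set H :=
  closure (linear_span (\bigcup_(E in P) E)).

(* The orthogonal projection onto E sends x to the only p in E with x - p
   orthogonal to E; see orthoprojP for its existence. *)
Definition orthoproj E (x : H) : H :=
  xget 0 [set p | E p /\ forall y, E y -> inner (x - p) y = 0].

Let N (x : H) : R := complex.Re `|x|.

Let normE x : `|x| = (N x)%:C%C.
Proof. by rewrite RRe_real // normr_real. Qed.

Let N_ge0 x : 0 <= N x.
Proof. by rewrite -lecR -normE normr_ge0. Qed.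

Let parallelogram u v : N (u + v) ^+ 2 + N (u - v) ^+ 2 =
  (N u ^+ 2 + N v ^+ 2) *+ 2.
Proof.
apply: (@complexI R); rewrite rmorphMn !rmorphD !rmorphXn /= -!normE.
by rewrite -!inner_norm dnormD dnormB addrACA subrr addr0 mulr2n.
Qed.

Let nearest_orthogonal E (u : H) : closed_subspace E ->
  (forall y, E y -> N u <= N (u - y)) -> forall y, E y -> inner u y = 0.
Proof.
move=> [E0 Elin _] umin y Ey; apply/eqP; apply: contraT => uy0.
have y0 : y != 0 by apply: contraNneq uy0 => ->; rewrite linear0r.
have yy0 : 0 < inner y y by rewrite dnorm_gt0.
pose a := inner u y / inner y y.
have Eay : E (a *: y) by rewrite -[a *: y]addr0; apply: Elin.
have : `|u| ^+ 2 <= `|u - a *: y| ^+ 2.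
  by rewrite lerXn2r ?nnegrE // !normE lecR; exact: umin.
rewrite -!inner_norm dnormB dnormZ linearZr_LR /= /a.
move: (inner u y) (inner y y) (inner u u) uy0 yy0 => c n w c0 n0.
have nC : n^* = n by rewrite conj_Creal // gtr0_real.
have -> : (c / n)^* * c = `|c| ^+ 2 / n.
  by rewrite rmorphM fmorphV /= nC normCK mulrC mulrA.
rewrite normf_div expr_div_n (gtr0_norm n0) rmorphM fmorphV /= nC.
rewrite rmorphXn /= (CrealP (normr_real c)) expr2 (expr2 n) invfM -!mulrA.
rewrite mulVf ?mulr1 ?gt_eqF //.
rewrite -addrA lerDl opprD addrA subrr sub0r oppr_ge0 lt_geF //.
by rewrite !mulr_gt0 ?normr_gt0 ?invr_gt0.
Qed.

Lemma orthoprojP E x : closed_subspace E ->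
  E (orthoproj E x) /\ forall y, E y -> inner (x - orthoproj E x) y = 0.
Proof.
move=> Esub; have [E0 Elin Ecl] := Esub.
pose S := [set N (x - y) | y in E].
have S_inf : has_inf S.
  by split; [exists (N (x - 0)), 0 | exists 0 => _ [y _ <-]].
pose m := inf S.
have mE y : E y -> m <= N (x - y).
  by move=> Ey; apply: ge_inf; [exact: S_inf.2 | exists y].
have m0 : 0 <= m by apply: lb_le_inf S_inf.1 _ => _ [y _ <-].
pose B t := [set y | E y /\ N (x - y) < m + t].
pose F := filter_from [set t : R | 0 < t] B.
have FF : ProperFilter F.
  apply: filter_from_proper.
    apply: filter_from_filter; first by exists 1 => /=.
    move=> s t /= s0 t0; exists (Num.min s t); first by rewrite /= lt_min s0.
    move=> y [Ey]; rewrite -ltrBlDl lt_min => /andP[ys yt].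
    by split; split=> //; rewrite -ltrBlDl.
  move=> t /= t0; have [_ [y Ey <-] yt] := inf_adherent t0 S_inf.
  by exists y.
have Bdiam (t : R) y z : 0 < t -> t <= 1 -> B t y -> B t z ->
    N (y - z) ^+ 2 <= ((m *+ 2 + 1) * t) *+ 4.
  move=> t0 t1 [Ey yt] [Ez zt].
  have := parallelogram (x - y) (x - z).
  have -> : x - y - (x - z) = - (y - z)
    by rewrite !opprB addrC addrA subrK.
  have -> : x - y + (x - z) = 2 *: (x - 2^-1 *: (y + z)).
    rewrite scalerBr scalerA divff ?pnatr_eq0 // scale1r scaler_nat mulr2n.
    by rewrite opprD addrACA.
  have NZ c v : N (c%:C%C *: v) = `|c| * N v.
    apply: (@complexI R); rewrite -normE normrZ rmorphM /= -normE.
    by rewrite normc_def /= expr0n /= addr0 sqrtr_sqr.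
  have NN v : N (- v) = N v by rewrite /N normrN.
  have Ew : E ((2^-1 : R)%:C%C *: (y + z)).
    rewrite -[_ *: _]addr0; apply: (Elin) => //.
    by rewrite -[y]scale1r; apply: Elin.
  have := mE _ Ew; rewrite NN.
  have -> : 2 = (2 : R)%:C%C :> R[i] by rewrite rmorph_nat.
  rewrite NZ -fmorphV /=.
  move: (N (x - _)) (N (x - y)) (N (x - z)) (N (y - z))
    (N_ge0 (x - y)) (N_ge0 (x - z)) yt zt => a b c e b0 c0 bm cm am.
  by rewrite normr_nat => eq; nra.
have Fcauchy : cauchy F.
  apply/cauchyP => e e0; have eE : e = (complex.Re e)%:C%C.
    by rewrite RRe_real // gtr0_real.
  move: e0; rewrite eE; set r := complex.Re e; rewrite (ltcR 0) => r0.
  have k0 : 0 < (m *+ 2 + 1) * 8.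
    by rewrite mulr_gt0 // ltr_wpDl // mulrn_wge0.
  pose t := Num.min 1 (r ^+ 2 / ((m *+ 2 + 1) * 8)).
  have t0 : 0 < t by rewrite lt_min ltr01 divr_gt0 ?exprn_gt0.
  have t1 : t <= 1 by rewrite ge_min lexx.
  have tk : t * ((m *+ 2 + 1) * 8) <= r ^+ 2.
    by rewrite -ler_pdivlMr // ge_min lexx orbT.
  have [y By] : B t !=set0 by apply: (@filter_ex _ F); exists t.
  exists y, t => // z Bz; rewrite -ball_normE /= normE ltcR.
  rewrite -(ltr_pXn2r (n := 2)) ?nnegrE ?N_ge0 ?ltW //.
  have := Bdiam _ _ _ t0 t1 By Bz.
  have := exprn_gt0 2 r0.
  by move: (N _ ^+ 2) (r ^+ 2) tk => p q; lra.
have [p Fp] := (cvg_ex F).1 (cauchy_cvg F Fcauchy).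
have FB t : 0 < t -> F (B t) by move=> t0; exists t.
have Fball (t : R) : 0 < t -> F (ball p t%:C%C).
  by move=> t0; apply: Fp; apply: nbhsx_ballx; rewrite (ltcR 0).
have Ep : E p.
  apply: Ecl => A /Fp FA.
  have [y [[Ey _] Ay]] := filter_ex (filterI (FB 1 ltr01) FA).
  by exists y.
have Np : N (x - p) <= m.
  apply/ler_addgt0Pr => t t0; have t20 : 0 < t / 2 by rewrite divr_gt0.
  have [z [[_ mz]]] := filter_ex (filterI (FB _ t20) (Fball _ t20)).
  rewrite -ball_normE /= normE ltcR => pz.
  have : N (x - p) <= N (x - z) + N (p - z).
    rewrite -lecR rmorphD /= -!normE (distrC p).
    have -> : x - p = x - z + (z - p) by rewrite addrA subrK.
    exact: ler_normD.
  lra.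
have px : E p /\ forall y, E y -> inner (x - p) y = 0.
  split=> //; apply: nearest_orthogonal => // y Ey.
  rewrite (le_trans Np) // -addrA -opprD; apply: mE.
  by rewrite -[p]scale1r; apply: Elin.
exact: (@xgetI _ 0
  [set q | E q /\ forall y, E y -> inner (x - q) y = 0] p px).
Qed.

Record subspace_lattice := SubspaceLattice {
  sl_mem :> set H -> Prop;
  sl_subspace : forall E, sl_mem E -> closed_subspace E;
  sl_bot : sl_mem [set 0];
  sl_top : sl_mem [set: H];
  sl_meet : forall P, P `<=` sl_mem -> sl_mem (\bigcap_(E in P) E);
  sl_join : forall P, P `<=` sl_mem -> sl_mem (join P)
}.

Variable L : subspace_lattice.

Definition commutative_lattice :=
  forall E F, L E -> L F ->
    orthoproj E \o orthoproj F = orthoproj F \o orthoproj E.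

(* lminus E is E_- *)
Definition lminus E := join [set F | L F /\ ~ (E `<=` F)].

Definition completely_distributive :=
  forall K, L K -> K = join [set E | L E /\ ~ (K `<=` lminus E)].

Definition alg_set : set (bop H) :=
  [set T | forall E, L E -> forall x, E x -> E (T x)].

Definition alg_pred : pred (bop H) := fun T => T \in alg_set.

Fact alg_subring : subring_closed alg_pred.
Proof.
split=> [|S T /set_mem LS /set_mem LT|S T /set_mem LS /set_mem LT];
  apply/mem_set => E LE x Ex.
- exact: Ex.
- have [_ Elin _] := sl_subspace LE.
  have -> : (S - T) x = -1 *: T x + S x by rewrite scaleN1r addrC.
  by apply: Elin; [exact: LT|exact: LS].
- by apply: (LS _ LE); apply: LT.
Qed.

Fact alg_submod : submod_closed alg_pred.
Proof.
split=> [|a S T /set_mem LS /set_mem LT]; apply/mem_set => E LE x Ex;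
  have [E0 Elin _] := sl_subspace LE => //.
by apply: Elin; [exact: LS|exact: LT].
Qed.
HB.instance Definition _ := GRing.isSubringClosed.Build (bop H) alg_pred
  alg_subring.
HB.instance Definition _ := GRing.isSubmodClosed.Build R[i] (bop H) alg_pred
  (GRing.submod_closed_semi alg_submod).

Record Alg := MkAlg { alg_op :> bop H; _ : alg_op \in alg_pred }.
HB.instance Definition _ := [isSub for alg_op].
HB.instance Definition _ := [Choice of Alg by <:].
HB.instance Definition _ := GRing.SubChoice_isSubPzRing.Build (bop H) alg_pred
  Alg alg_subring.
HB.instance Definition _ := [SubZmodule_isSubLmodule of Alg by <:].

Definition bounded_map (d : Alg -> Alg) :=
  exists M : R, forall A, opnorm (d A) <= M * opnorm A.

End SubspaceLattices.

Section Derivations.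
Variables (A : pzRingType) (d : A -> A).

Definition jordan_derivable_at_zero := forall a b, a * b + b * a = 0 ->
  d (a * b + b * a) = d a * b + a * d b + d b * a + b * d a.

Definition derivation := forall a b, d (a * b) = d a * b + a * d b.

Definition generalized_derivation :=
  forall a b, d (a * b) = d a * b + a * d b - a * d 1 * b.

End Derivations.

(* Main.v *)
Require Import Defs.
From HB Require Import structures.
From mathcomp Require Import all_boot all_order all_algebra.
From mathcomp Require Import sesquilinear complex.
From mathcomp Require Import all_classical all_reals all_analysis.

Set Implicit Arguments.
Unset Strict Implicit.
Unset Printing Implicit Defensive.

Import Order.TTheory GRing.Theory Num.Theory.
Import numFieldNormedType.Exports.

Local Open Scope classical_set_scope.
Local Open Scope ring_scope.

(* Write a o b = ab + ba. If d is Jordan derivable at zero, evaluating at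
   p o (1 - p) = 0 shows that d 1 commutes with every idempotent p, and after
   replacing d by d - d 1 * _ one gets d (p o x) = d p o x + p o d x for all x.
   Fix E in L and y orthogonal to E_-, so that the rank-one operators x (x) y,
   x in E, lie in Alg L. If y is orthogonal to E, they map the complement of E
   into E and kill E, and the product rule d (a r) = d a r + a d r for such r
   is a Peirce computation relative to the invariant projection E. Otherwise
   they are combinations of rank-one idempotents p, for which the off-diagonal
   Peirce corners, being square-zero, cannot be exchanged by d, and again
   d (a p) = d a p + a d p. Expanding d (a b r) in two ways, the defect
   d (a b) - d a b - a d b kills every such rank-one r. By complete
   distributivity these separate the elements of Alg L, so the defect vanishes;
   the same separation makes d 1 central. *)

(** * Jordan derivability at zero in a ring *)

Lemma subrACA (V : zmodType) (x y z t : V) :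
  (x - y) - (z - t) = (x - z) - (y - t).
Proof. by rewrite opprD addrACA -opprD. Qed.

Section AntiCommutator.
Variable A : pzRingType.
Implicit Types a b c : A.

Definition anticomm a b := a * b + b * a.

Lemma anticommC a b : anticomm a b = anticomm b a.
Proof. exact: addrC. Qed.

Lemma anticommBr a : {morph anticomm a : b c / b - c}.
Proof. by move=> b c; rewrite /anticomm mulrBl mulrBr addrACA -opprD. Qed.

Lemma anticomm1 a : anticomm 1 a = a *+ 2.
Proof. by rewrite /anticomm mul1r mulr1. Qed.

End AntiCommutator.

Section JordanDefect.
Variables (A : pzRingType) (d : {additive A -> A}).
Implicit Types a b c p x : A.

(** Being symmetric and additive in each argument, it turns vanishing on pairs with
    [a * b + b * a = 0] into vanishing on sums of such pairs. *)
Definition jordan_defect a b :=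
  d (anticomm a b) - anticomm (d a) b - anticomm a (d b).

Lemma jordan_defectC a b : jordan_defect a b = jordan_defect b a.
Proof.
rewrite /jordan_defect (anticommC b a) (anticommC (d b)) (anticommC b).
exact: addrAC.
Qed.

Lemma jordan_defect_zmod a : zmod_morphism (jordan_defect a).
Proof.
move=> b c; rewrite /jordan_defect (anticommBr a) !(raddfB d) !anticommBr.
by rewrite (subrACA (d _) (d _)) (subrACA (d _ - _) (d _ - _)).
Qed.
HB.instance Definition _ a :=
  GRing.isZmodMorphism.Build A A (jordan_defect a) (jordan_defect_zmod a).

Hypothesis dJ : jordan_derivable_at_zero d.

Lemma jordan_defect_eq0 a b : a * b + b * a = 0 -> jordan_defect a b = 0.
Proof.
move=> ab0; apply/eqP; rewrite /jordan_defect /anticomm dJ //.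
rewrite -addrA -opprD subr_eq0; apply/eqP.
by rewrite [LHS](ACl ((1*4)*(2*3))).
Qed.

Lemma jordan_defect_idempotent p : p * p = p ->
  jordan_defect p 1 = jordan_defect p p.
Proof.
move=> pp; apply/eqP; rewrite -subr_eq0 -raddfB; apply/eqP.
by apply: jordan_defect_eq0; rewrite mulrBl mulrBr mul1r mulr1 pp subrr addr0.
Qed.

Lemma jordan_at_zero1_commute p : p * p = p -> d 1 * p = p * d 1.
Proof.
move=> pp; have := jordan_defect_idempotent pp.
rewrite [LHS]jordan_defectC /jordan_defect !anticomm1 [anticomm p p]/anticomm.
rewrite pp -mulr2n raddfMn addrAC subrr sub0r (anticommC (d p)) -addrA -opprD.
rewrite -mulr2n -mulrnBl -[RHS]opprK -mulNrn opprB => /oppr_inj E.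
have pdp : p * anticomm p (d p) = p * d p + p * d p * p.
  by rewrite /anticomm mulrDr !mulrA pp.
have dpp : anticomm p (d p) * p = p * d p * p + d p * p.
  by rewrite /anticomm mulrDl -(mulrA (d p)) pp.
(* By [E], both sides equal [(p * d p * p) *+ 2]. *)
have Ep : p * anticomm (d 1) p = anticomm (d 1) p * p.
  rewrite E mulrnAl mulrnAr mulrBl mulrBr pdp dpp addrK.
  by rewrite [X in X - p * d p]addrC addrK.
move: Ep; rewrite /anticomm mulrDl mulrDr !mulrA pp -(mulrA (d 1)) pp addrC.
by rewrite addrC [RHS]addrC => /addrI.
Qed.

Hypothesis two_inj : forall x : A, x *+ 2 = 0 -> x = 0.
Hypothesis d1 : d 1 = 0.

Lemma jordan_defect1 x : jordan_defect 1 x = 0.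
Proof.
rewrite /jordan_defect d1 anticommC [anticomm x 1]anticommC !anticomm1 raddfMn.
by rewrite /anticomm mulr0 mul0r addr0 subr0 subrr.
Qed.

(* The Peirce components of [x] in [pAp] and in the corners [pA(1-p)], [(1-p)Ap]
   anticommute with [1 - p] and [2p - 1] respectively. *)
Lemma jordan_defect_idempotentl p x : p * p = p -> jordan_defect p x = 0.
Proof.
move=> pp; set q := 1 - p.
have pq : p * q = 0 by rewrite mulrBr mulr1 pp subrr.
have qp : q * p = 0 by rewrite mulrBl mul1r pp subrr.
have defC y : p * y + y * p = y -> jordan_defect p y = 0.
  move=> py; apply: two_inj; rewrite mulr2n jordan_defectC -raddfD.
  rewrite -[p + p](subrK 1) raddfD /= [jordan_defect y 1]jordan_defectC.
  rewrite jordan_defect1 addr0; apply: jordan_defect_eq0.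
  rewrite mulrBr mulrBl mulr1 mul1r mulrDl mulrDr addrACA (addrACA (y * p)).
  by rewrite [y * p + _]addrC py -opprD subrr.
have -> : x = p * x * p + (p * x * q + q * x * p) + q * x * q.
  have {1}-> : x = (p + q) * x * (p + q) by rewrite addrC subrK mulr1 mul1r.
  by rewrite mulrDl mulrDl !mulrDr [LHS](AC (2*2) ((1*(2*3))*4)).
have xpq : jordan_defect p (p * x * q) = 0.
  by apply: defC; rewrite !mulrA pp -[_ * q * p]mulrA qp mulr0 addr0.
have xqp : jordan_defect p (q * x * p) = 0.
  by apply: defC; rewrite !mulrA pq !mul0r -[_ * p * p]mulrA pp add0r.
rewrite !raddfD /= xpq xqp.
rewrite [jordan_defect p (q * x * q)]jordan_defect_eq0; last first.
  by rewrite !mulrA pq !mul0r -[_ * q * p]mulrA qp mulr0 addr0.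
rewrite !addr0 jordan_defectC -[in X in jordan_defect _ X](subKr 1 p).
rewrite raddfB /= jordan_defectC jordan_defect1 jordan_defectC.
rewrite jordan_defect_eq0 ?subrr // -/q.
by rewrite !mulrA qp -[_ * p * q]mulrA pq !mul0r mulr0 addr0.
Qed.

Lemma jordan_idempotent_mul p x : p * p = p ->
  d (p * x + x * p) = d p * x + x * d p + (p * d x + d x * p).
Proof.
move=> /(@jordan_defect_idempotentl p x)/eqP.
by rewrite /jordan_defect -addrA -opprD subr_eq0 => /eqP.
Qed.

Lemma deriv_idempotent p : p * p = p -> d p = d p * p + p * d p.
Proof.
move=> pp; have := jordan_idempotent_mul p pp.
rewrite pp raddfD [p * _ + _]addrC /= -!mulr2n => /eqP.
by rewrite -subr_eq0 -mulrnBl => /eqP/two_inj/eqP; rewrite subr_eq0 => /eqP.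
Qed.

Lemma idempotent_deriv_idempotent p : p * p = p -> p * d p * p = 0.
Proof.
move=> pp; have /(congr1 ( *%R p)) := deriv_idempotent pp.
by rewrite mulrDr !mulrA pp addrC -[LHS]addr0 => /addrI.
Qed.

(** * Product rule on the corner of an invariant idempotent *)

Section InvariantIdempotent.
Variable p : A.
Hypotheses (pp : p * p = p) (p_inv : forall a, a * p = p * a * p).

Let dpp : d p * p = 0.
Proof. by rewrite p_inv idempotent_deriv_idempotent. Qed.

(** By [step], passing from [y] to [p * y] doubles [d y * p]. Since [p] fixes [p * x], the value at
    [p * x] is its own double, hence zero; but it is also twice the value at [x]. *)
Lemma deriv_mulr_idempotent_eq0 x : x * p = 0 -> d x * p = 0.
Proof.
have step y : y * p = 0 -> d (p * y) * p = d y * p *+ 2.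
  move=> yp; have := jordan_idempotent_mul y pp; rewrite yp addr0 => ->.
  rewrite !mulrDl -!mulrA yp dpp pp !mulr0 !add0r.
  by rewrite [p * _]mulrA -p_inv -mulr2n.
move=> xp; apply: two_inj; rewrite -step //.
have /step : p * x * p = 0 by rewrite -mulrA xp mulr0.
rewrite mulrA pp mulr2n -[LHS]addr0 => /addrI; exact: esym.
Qed.

(** Since [r * (a * p) = 0], the product [a * r] is the anticommutator of [r] and [a * p]. Once the
    defect of [r] vanishes, only [d (a * p) * r] and [a * p * d r] survive in the expansion. *)
Lemma deriv_mul_corner r a : p * r = r -> r * p = 0 ->
  d (a * r) = d a * r + a * d r.
Proof.
move=> pr rp; have drp := deriv_mulr_idempotent_eq0 rp.
have rp0 x : r * (p * x) = 0 by rewrite mulrA rp mul0r.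
have rdp : r * d p = 0 by rewrite (deriv_idempotent pp) dpp add0r rp0.
have dpr : d p * r = 0 by rewrite -pr mulrA dpp mul0r.
have pdr : p * d r = d r.
  have := jordan_idempotent_mul r pp.
  by rewrite pr rp addr0 rdp drp dpr add0r addr0 add0r.
have pb : p * (a * p) = a * p by rewrite mulrA -p_inv.
have bp : a * p * p = a * p by rewrite -mulrA pp.
have rb : r * (a * p) = 0 by rewrite -pb rp0.
have rdb : r * d (a * p) = 0.
  apply: two_inj; have := congr1 ( *%R r) (jordan_idempotent_mul (a * p) pp).
  rewrite pb bp raddfD /= !mulrDr -mulr2n rp0 (p_inv (d _)) -[p * _ * p]mulrA.
  rewrite rp0 [r * (d p * _)]mulrA rdp mul0r [r * (_ * d p)]mulrA rb mul0r.
  by rewrite !addr0.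
have drb : d r * (a * p) = 0 by rewrite -pb mulrA drp mul0r.
(* [r] is the difference of the idempotents [p + r] and [p]. *)
have r_defect x : jordan_defect r x = 0.
  have rr : r * r = 0 by rewrite -{2}pr rp0.
  have /(@jordan_defect_idempotentl (p + r) x) : (p + r) * (p + r) = p + r.
    by rewrite mulrDl !mulrDr pp pr rp rr !addr0.
  rewrite jordan_defectC raddfD /= jordan_defectC jordan_defect_idempotentl //.
  by rewrite add0r jordan_defectC.
(* [a * p - a] is annihilated by [p] on the right, hence so is its image under [d]. *)
have dab : d (a * p) * r = d a * r.
  apply/eqP; rewrite -subr_eq0 -mulrBl -raddfB -pr mulrA.
  by rewrite deriv_mulr_idempotent_eq0 ?mul0r // mulrBl bp subrr.
have -> : a * r = anticomm r (a * p) by rewrite /anticomm rb add0r -mulrA pr.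
have := r_defect (a * p); rewrite /jordan_defect /anticomm rdb add0r.
rewrite drb add0r dab -(mulrA a p (d r)) pdr -addrA -opprD => /eqP.
by rewrite subr_eq0 [a * d r + _]addrC => /eqP.
Qed.

End InvariantIdempotent.

(** * Product rule at a minimal idempotent *)

Section MinimalIdempotent.
Variable p : A.
Hypothesis pp : p * p = p.
Hypothesis p_prime : forall x y, x * p = x -> p * y = y -> x * y = 0 ->
  x = 0 \/ y = 0.
Hypothesis dpAp : forall a,
  d (p * a * p) = d (p * a * p) * p + p * a * p * d p.

Let square_zero x : x * x = 0 -> d x * x + x * d x = 0.
Proof.
move=> xx; apply: two_inj; rewrite mulr2n addrA.
by rewrite -dJ xx addr0 ?raddf0.
Qed.

(** The identity is additive in [a], so it is checked on the four Peirce components. In an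
    off-diagonal corner [x] is square-zero; compressing [d x * x + x * d x = 0] gives a zero
    product, and [p_prime] then excludes any component of [d x] in the opposite corner unless
    [x = 0]. *)
Lemma deriv_mul_minimal a : d (a * p) = d a * p + a * d p.
Proof.
set q := 1 - p; have pdpp := idempotent_deriv_idempotent pp.
have dpE := deriv_idempotent pp.
have pq : p * q = 0 by rewrite mulrBr mulr1 pp subrr.
have qp : q * p = 0 by rewrite mulrBl mul1r pp subrr.
have split_l y : y = p * y + q * y by rewrite -mulrDl addrC subrK mul1r.
have split_r y : y = y * p + y * q by rewrite -mulrDr addrC subrK mulr1.
clearbody q.
pose good x := d (x * p) = d x * p + x * d p.
have goodD x y : good x -> good y -> good (x + y).
  by move=> gx gy; rewrite /good !mulrDl !raddfD /= !mulrDl gx gy addrACA.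
have good0 : good 0 by rewrite /good !mul0r raddf0 !mul0r addr0.
have xdp x : x * p = 0 -> x * d p = x * d p * p.
  by move=> xp; rewrite {1}dpE mulrDr !mulrA xp mul0r addr0.
have peirce12 x : p * x = x -> x * p = 0 -> good x.
  move=> px xp.
  have qx : q * x = 0 by rewrite -px mulrA qp mul0r.
  have [u0|->//] : q * d x * p = 0 \/ x = 0.
    apply: p_prime => //; first by rewrite -[_ * p * p]mulrA pp.
    have xx : x * x = 0 by rewrite -{2}px mulrA xp mul0r.
    have /(congr1 ( *%R q)) := square_zero xx.
    by rewrite mulrDr mulr0 -[_ * p * x]mulrA px !mulrA qx mul0r addr0.
  have := congr1 ( *%R^~ p) (jordan_idempotent_mul x pp).
  rewrite /= /good xp raddf0 px addr0 (xdp x xp) !mulrDl -!mulrA xp pp mulr0.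
  rewrite add0r addrA addrC -[LHS]addr0 => /addrI => E.
  by rewrite {1}(split_l (d x)) mulrDl u0 addr0 -mulrA addrC.
have peirce21 x : x * p = x -> p * x = 0 -> good x.
  move=> xp px.
  have xq : x * q = 0 by rewrite -xp -mulrA pq mulr0.
  have [->//|u0] : x = 0 \/ p * d x * q = 0.
    apply: p_prime => //; first by rewrite !mulrA pp.
    have xx : x * x = 0 by rewrite -{1}xp -mulrA px mulr0.
    have /(congr1 ( *%R^~ q)) := square_zero xx.
    by rewrite /= mulrDl mul0r -[_ * x * q]mulrA xq mulr0 add0r !mulrA xp.
  have pdx : p * d x = p * d x * p by rewrite {1}(split_r (p * d x)) u0 addr0.
  have dE : d x = d p * x + x * d p + (p * d x + d x * p).
    by rewrite -jordan_idempotent_mul // px xp add0r.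
  have tx : d p * x = p * d p * x.
    by rewrite {1}dpE mulrDl -mulrA px mulr0 add0r.
  (* Left multiplication of [dE] by [p] isolates this sum; what is left of [dE] is the claim. *)
  have tp0 : d p * x + p * d x = 0.
    have := congr1 ( *%R p) dE.
    rewrite !mulrDr [p * (x * _)]mulrA px mul0r addr0 !mulrA pp -pdx -tx addrA.
    by rewrite addrC -[LHS]addr0 => /addrI; exact: esym.
  by rewrite /good xp {1}dE addrACA tp0 add0r addrC.
have peirce22 x : p * x = 0 -> x * p = 0 -> good x.
  move=> px xp; have := congr1 ( *%R^~ p) (jordan_idempotent_mul x pp).
  rewrite /= /good px xp addr0 raddf0 mul0r !mulrDl -mulrA xp mulr0 add0r.
  rewrite -[_ * p * p]mulrA pp -xdp // => E.
  (* Left multiplication of [E] by [p] yields twice this compression. *)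
  suff pdxp : p * d x * p = 0 by rewrite E pdxp add0r addrC.
  apply: two_inj; have := congr1 ( *%R p) E.
  by rewrite mulr0 !mulrDr !mulrA pp px mul0r add0r mulr2n => <-.
rewrite -/(good a) (split_l a) (split_r (p * a)) (split_r (q * a)).
apply: (goodD); apply: (goodD).
- by rewrite /good -{1}mulrA pp.
- by apply: peirce12; rewrite ?mulrA ?pp // -mulrA qp mulr0.
- by apply: peirce21; rewrite ?mulrA ?pq ?mul0r // -mulrA pp.
- by apply: peirce22; rewrite ?mulrA ?pq ?mul0r // -mulrA qp mulr0.
Qed.

End MinimalIdempotent.

End JordanDefect.

(** * Reduction to maps vanishing at the identity *)

Section Normalization.
Variables (A : pzRingType) (d : {additive A -> A}).

Definition normalized a := d a - d 1 * a.

Lemma normalized_zmod : zmod_morphism normalized.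
Proof. by move=> a b; rewrite /normalized raddfB mulrBr subrACA. Qed.
HB.instance Definition _ :=
  GRing.isZmodMorphism.Build A A normalized normalized_zmod.

Lemma normalized1 : normalized 1 = 0.
Proof. by rewrite /normalized mulr1 subrr. Qed.

Hypothesis d1C : forall a, d 1 * a = a * d 1.

(** The correction terms are [d 1 * (a * b)] and [d 1 * (b * a)], each twice, and they cancel
    because [b * a = - (a * b)]. *)
Lemma normalized_jordan :
  jordan_derivable_at_zero d -> jordan_derivable_at_zero normalized.
Proof.
move=> dJ a b ab0; have dab := dJ a b ab0; rewrite ab0 !raddf0 in dab *.
have ba : b * a = - (a * b) by apply/eqP; rewrite -addr_eq0 addrC ab0.
rewrite /normalized !mulrBl !mulrBr !mulrA -!d1C -!(mulrA (d 1)) ba mulrN opprK.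
rewrite [RHS](AC (((2*2)*2)*2) (((1*3)*5*7)*((2*6)*(4*8)))) /=.
by rewrite !addNr !addr0.
Qed.

Lemma generalized_derivation_normalized :
  derivation normalized -> generalized_derivation d.
Proof.
move=> dN a b; rewrite -[LHS](subrK (d 1 * (a * b))).
rewrite -/(normalized _) dN /normalized mulrBl mulrBr !mulrA -(d1C a).
by rewrite addrA subrK addrAC.
Qed.

(** The correction terms add up to [d 1 * (a * b + b * a)]. *)
Lemma generalized_derivation_jordan :
  generalized_derivation d -> jordan_derivable_at_zero d.
Proof.
move=> dG a b ab0; rewrite raddfD /= !dG addrACA -opprD -!d1C -!mulrA -mulrDr.
by rewrite ab0 mulr0 subr0 addrA.
Qed.

End Normalization.

(** * Rank-one operators and projections *)

Section HilbertSpace.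
Variables (R : realType) (H : hilbertType R).
Implicit Types (x y z : H) (E : set H).

Lemma inner_pythagoras x y :
  inner x y = 0 -> `|x + y| ^+ 2 = `|x| ^+ 2 + `|y| ^+ 2.
Proof. by move=> xy0; rewrite -!inner_norm dnormD xy0 conjC0 !addr0. Qed.

Lemma inner_eq0C x y : inner x y = 0 -> inner y x = 0.
Proof.
by move=> xy0; rewrite (hermC inner y x) [X in _ * _ X]xy0 rmorph0 mulr0.
Qed.

Lemma cauchy_schwarz x y : `|inner x y| <= `|x| * `|y|.
Proof.
have [->|y0] := eqVneq y 0; first by rewrite linear0r !normr0 mulr0.
have yy0 : inner y y != 0 by rewrite dnorm_eq0.
(* [a *: y] is the projection of [x] on the line of [y], so it is no longer than [x]. *)
pose a := inner x y / inner y y.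
have xay : inner (x - a *: y) (a *: y) = 0.
  by rewrite linearZr_LR /= linearBl linearZl_LR /= /a divfK // subrr mulr0.
have : `|a *: y| ^+ 2 <= `|x| ^+ 2.
  by rewrite -{1}(subrK (a *: y) x) inner_pythagoras // lerDr exprn_ge0.
rewrite ler_pXn2r ?nnegrE // => ayx.
have -> : inner x y = a * `|y| ^+ 2 by rewrite -inner_norm divfK.
rewrite normrM normrX normr_id expr2 mulrA ler_wpM2r //.
by rewrite -normrZ.
Qed.

Fact rank1_subproof x y : (fun z => inner z y *: x) \in @bounded_operator R H.
Proof.
apply/asboolP; split=> [a u v|].
  by rewrite linearPl /= scalerDl scalerA.
exists (`|x| * `|y|) => z; rewrite normrZ mulrC -mulrA ler_wpM2l //.
by rewrite [leRHS]mulrC cauchy_schwarz.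
Qed.
Definition rank1 x y : bop H := Bop (rank1_subproof x y).

(** [orthoproj] is defined by choice; uniqueness is what makes it computable. The difference of two
    candidates lies in [E] and is orthogonal to [E]. *)
Lemma orthoproj_unique E x p : closed_subspace E -> E p ->
  (forall y, E y -> inner (x - p) y = 0) -> orthoproj E x = p.
Proof.
move=> Esub Ep px; have [Eq qx] := orthoprojP x Esub.
have [_ Elin _] := Esub; set q := orthoproj E x in Eq qx *.
have Epq : E (q - p) by rewrite addrC -scaleN1r; apply: Elin.
apply/eqP; rewrite -subr_eq0 -(dnorm_eq0 inner).
have {1}-> : q - p = (x - p) - (x - q) by rewrite opprB [RHS]addrC addrA subrK.
by rewrite linearBl /= px // qx // subrr.
Qed.

Fact orthoproj_subproof E : closed_subspace E ->
  orthoproj E \in @bounded_operator R H.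
Proof.
move=> Esub; have [_ Elin _] := Esub.
apply/asboolP; split=> [a x y|].
  have [[Ex ox] [Ey oy]] := (orthoprojP x Esub, orthoprojP y Esub).
  apply: orthoproj_unique => // [|z Ez]; first exact: Elin.
  by rewrite opprD addrACA -scalerBr linearPl /= ox // oy // mulr0 addr0.
exists 1 => x; rewrite mul1r; have [Ex ox] := orthoprojP x Esub.
rewrite -(ler_pXn2r (ltn0Sn 1)) ?nnegrE //.
rewrite -[X in _ <= `|X| ^+ 2](subrK (orthoproj E x) x).
by rewrite inner_pythagoras ?ox // lerDr exprn_ge0.
Qed.
Definition orthoproj_bop E (Esub : closed_subspace E) : bop H :=
  Bop (orthoproj_subproof Esub).

Lemma orthoproj_id E x : closed_subspace E -> E x -> orthoproj E x = x.
Proof.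
by move=> Esub Ex; apply: orthoproj_unique => // y _; rewrite subrr linear0l.
Qed.

Lemma exists_orthogonal E : closed_subspace E -> E <> setT ->
  exists2 y, y != 0 & forall z, E z -> inner z y = 0.
Proof.
move=> Esub; apply: contra_notP => noy; apply/seteqP; split=> // x _.
have [Ep px] := orthoprojP x Esub; suff /eqP : x - orthoproj E x = 0.
  by rewrite subr_eq0 => /eqP ->.
apply: contra_notP noy => /eqP x0; exists (x - orthoproj E x) => // z Ez.
exact/inner_eq0C/px.
Qed.

Lemma bop_scale (T : bop H) a x : T (a *: x) = a *: T x.
Proof.
have T0 : T 0 = 0.
  by have := bop_linear T (-1) 0 0; rewrite !scaler0 addr0 scaleN1r addNr.
by have := bop_linear T a x 0; rewrite T0 !addr0.
Qed.

Lemma bop_sub (T : bop H) x y : T (x - y) = T x - T y.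
Proof. by rewrite addrC -scaleN1r bop_linear scaleN1r addrC. Qed.

Lemma bop_eq0_closure (T : bop H) (S : set H) :
  (forall x, S x -> T x = 0) -> forall x, closure S x -> T x = 0.
Proof.
move=> TS x Sx; apply/eqP; apply: contraT => Tx0.
have [M M0 TM] := bop_bounded T.
(* The bound [M] may be zero; adding 1 allows division by it. *)
have M1 : 0 < (M + 1)%:C%C :> R[i] by rewrite (ltcR 0) ltr_wpDl.
have e0 : 0 < `|T x| / (M + 1)%:C%C by rewrite divr_gt0 ?normr_gt0.
have [y [Sy]] := Sx _ (nbhsx_ballx x _ e0).
rewrite -ball_normE /= ltr_pdivlMr // => xy.
have : `|T x| <= `|x - y| * (M + 1)%:C%C.
  rewrite -[T x]subr0 -(TS y) // -bop_sub (le_trans (TM _)) //.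
  by rewrite mulrC ler_wpM2l // lecR lerDl.
by move=> /le_lt_trans/(_ xy); rewrite ltxx.
Qed.

Lemma bop_eq0_join (T : bop H) (P : set (set H)) :
  (forall E x, P E -> E x -> T x = 0) -> forall x, join P x -> T x = 0.
Proof.
move=> TP; apply: bop_eq0_closure => _ [n [c [v [vP ->]]]].
elim: n c v vP => [|n IHn] c v vP.
  by rewrite big_ord0; have := bop_scale T 0 0; rewrite !scale0r.
have [E PE Ev] := vP ord0.
rewrite big_ord_recl bop_linear (TP E) // scaler0 add0r.
by apply: IHn => i; exact: vP.
Qed.

End HilbertSpace.

(** * The algebra of a subspace lattice *)

Section LatticeAlgebra.
Variables (R : realType) (H : hilbertType R) (L : subspace_lattice H).
Implicit Types (x y z : H) (E F : set H) (a b p r : Alg L).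

Lemma lminus_subspace E : closed_subspace (lminus L E).
Proof. by apply/(@sl_subspace _ _ L)/sl_join => F []. Qed.

Lemma subset_lminus E F : L F -> ~ (E `<=` F) -> F `<=` lminus L E.
Proof.
move=> LF nEF x Fx; apply: subset_closure; exists 1%N, (fun=> 1), (fun=> x).
by split=> [_|]; [exists F | rewrite big_ord1 scale1r].
Qed.

Lemma AlgP a b : (forall x, a x = b x) -> a = b.
Proof. by move=> ab; apply/val_inj/bopP. Qed.

Lemma Alg_invariant a E x : L E -> E x -> E (a x).
Proof. by move=> LE; apply: (set_mem (valP a)). Qed.

Lemma AlgME a b x : (a * b) x = a (b x). Proof. by []. Qed.
Lemma AlgDE a b x : (a + b) x = a x + b x. Proof. by []. Qed.
Lemma AlgZE c a x : (c *: a) x = c *: a x. Proof. by []. Qed.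

Lemma Alg_scalerAl c a b : c *: (a * b) = (c *: a) * b.
Proof. exact: AlgP. Qed.

Lemma Alg_scalerAr c a b : c *: (a * b) = a * (c *: b).
Proof. by apply: AlgP => x; rewrite AlgME !AlgZE bop_scale. Qed.

Lemma Alg_mulr2n_eq0 a : a *+ 2 = 0 -> a = 0.
Proof.
move=> a0; rewrite -[a]scale1r -(mulVf (_ : 2 != 0 :> R[i])) ?pnatr_eq0 //.
by rewrite -scalerA scaler_nat a0 scaler0.
Qed.

(** A member [F] of the lattice either contains [E], hence the range of the operator, or lies below
    [lminus L E], where the operator vanishes. *)
Lemma rank1_alg E x y : L E -> E x ->
  (forall z, lminus L E z -> inner z y = 0) -> rank1 x y \in alg_pred L.
Proof.
move=> LE Ex yE; apply/mem_set => F LF z Fz /=.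
have [F0 Flin _] := sl_subspace LF.
have [EF|nEF] := pselect (E `<=` F).
  by rewrite -[_ *: _]addr0; apply: (Flin) => //; exact: EF.
by rewrite yE ?scale0r //; exact: subset_lminus nEF _ Fz.
Qed.

(** Commutativity enters here: on [F], the projection onto [E] agrees with its composite followed by
    the projection onto [F]. *)
Lemma orthoproj_alg E (Esub : closed_subspace E) : commutative_lattice L ->
  L E -> orthoproj_bop Esub \in alg_pred L.
Proof.
move=> Lcomm LE; apply/mem_set => F LF x Fx /=.
have Fsub := sl_subspace LF.
rewrite -[x in orthoproj E x](orthoproj_id Fsub Fx).
have /= -> := congr1 (@^~ x) (Lcomm _ _ LE LF).
by have [] := orthoprojP (orthoproj E x) Fsub.
Qed.

(* Complete distributivity enters only through the join formula for [H]. *)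
Lemma completely_distributive_eq0 a : completely_distributive L ->
  (forall E x, L E -> lminus L E <> setT -> E x -> a x = 0) -> a = 0.
Proof.
move=> Lcd aE; apply: AlgP => x.
apply: (@bop_eq0_join _ _ _ [set E | L E /\ ~ (setT `<=` lminus L E)]).
  by move=> E z [LE nE] Ez; apply: (aE E) => // ET; apply: nE; rewrite ET.
by rewrite -Lcd //; exact: sl_top.
Qed.

(** Rank one in ring terms, in the form [deriv_mul_minimal] asks for. Primeness is restricted to
    [A p] and [p A], since [Alg L] itself need not be prime. *)
Definition minimal_idempotent p :=
  [/\ p * p = p, forall a, exists c, p * a * p = c *: p &
      forall a b, a * p = a -> p * b = b -> a * b = 0 -> a = 0 \/ b = 0].

Lemma rank1_minimal_idempotent p x y :
  val p = rank1 x y -> inner x y = 1 -> minimal_idempotent p.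
Proof.
move=> pE xy1; have pz z : p z = inner z y *: x.
  by change (val p z = inner z y *: x); rewrite pE.
split=> [|a|a b ap pb ab0].
- by apply: AlgP => z; rewrite AlgME !pz linearZl_LR /= xy1 mulr1.
- exists (inner (a x) y); apply: AlgP => z.
  by rewrite AlgZE !AlgME !pz bop_scale linearZl_LR /= scalerA mulrC.
(* Here [a] and [b] factor through [p], so [a * b] sends [z] to [inner (b z) y *: a x]. *)
- have abE z : inner (b z) y *: a x = 0.
    by rewrite -bop_scale -pz -(AlgME p) pb -(AlgME a) ab0.
  have [ax0|ax0] := eqVneq (a x) 0; [left|right]; apply: AlgP => z.
    by rewrite -ap AlgME pz bop_scale ax0 scaler0.
  rewrite -pb AlgME pz; have /eqP := abE z.
  by rewrite scaler_eq0 (negPf ax0) orbF => /eqP ->; rewrite scale0r.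
Qed.

(** Reduces rank-one operators to the two ring situations above, so that centrality of [d 1] and the
    product rule share one case analysis. *)
Lemma rank1_ind (P : Alg L -> Prop) E y : commutative_lattice L -> L E ->
  (forall z, lminus L E z -> inner z y = 0) ->
  (forall r s, P r -> P s -> P (r + s)) ->
  (forall c r, P r -> P (c *: r)) ->
  (forall p, minimal_idempotent p -> P p) ->
  (forall p r, p * p = p -> (forall a, a * p = p * a * p) -> p * r = r ->
     r * p = 0 -> P r) ->
  forall x r, E x -> val r = rank1 x y -> P r.
Proof.
move=> Lcomm LE yE PD PZ Pmin Pcorner.
have [_ Elin _] := sl_subspace LE.
(* Rescaling [x] to have inner product 1 with [y] makes the operator idempotent. *)
have Pneq0 x r : inner x y != 0 -> E x -> val r = rank1 x y -> P r.
  move=> xy0 Ex rE; pose x' := (inner x y)^-1 *: x.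
  have Ex' : E x'.
    rewrite /x' -[_ *: x]addr0; apply: Elin => //; by have [] := sl_subspace LE.
  have -> : r = inner x y *: MkAlg (rank1_alg LE Ex' yE).
    apply: AlgP => z; rewrite AlgZE.
    change (val r z = inner x y *: rank1 x' y z).
    by rewrite rE /= scalerA scalerA mulrAC mulfV // mul1r.
  apply/PZ/Pmin/rank1_minimal_idempotent => //.
  by rewrite linearZl_LR /= mulVf.
move=> x r Ex rE.
have rz z : r z = inner z y *: x.
  by change (val r z = inner z y *: x); rewrite rE.
(* If [y] is orthogonal to [E], the projection onto [E] is the invariant idempotent and [r] lies in
   its corner. *)
have [yE0|] := pselect (forall z, E z -> inner z y = 0).
  have Esub := sl_subspace LE.
  apply: (Pcorner (MkAlg (orthoproj_alg Esub Lcomm LE))).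
  - apply: AlgP => z; rewrite AlgME /= orthoproj_id //.
    by have [] := orthoprojP z Esub.
  - move=> a; apply: AlgP => z; rewrite !AlgME /= [RHS]orthoproj_id //.
    by apply: Alg_invariant => //; have [] := orthoprojP z Esub.
  - apply: AlgP => z; rewrite AlgME rz /= orthoproj_id // -[_ *: x]addr0.
    by apply: Elin => //; have [] := Esub.
  - apply: AlgP => z; rewrite AlgME rz yE0 ?scale0r //.
    by have [] := orthoprojP z Esub.
move=> /existsNP[z /not_implyP[Ez /eqP zy0]].
have [xy0|xy0] := eqVneq (inner x y) 0; last exact: Pneq0 xy0 _ _.
have Exz : E (x + z) by rewrite -[x]scale1r; apply: Elin.
(* Both [x + z] and [z] have the same nonzero inner product with [y]. *)
have -> : r = MkAlg (rank1_alg LE Exz yE) + -1 *: MkAlg (rank1_alg LE Ez yE).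
  apply: AlgP => t; rewrite AlgDE AlgZE.
  change (val r t = rank1 (x + z) y t + -1 *: rank1 z y t).
  by rewrite rE /= scaleN1r scalerDr addrK.
apply: PD; first by apply: (@Pneq0 (x + z)); rewrite // linearDl /= xy0 add0r.
by apply/PZ/(@Pneq0 z).
Qed.

(** * Separation by rank-one operators, centrality and the derivation property *)

Section JordanDerivable.
Hypotheses (Lcomm : commutative_lattice L) (Lcd : completely_distributive L).

(** When [lminus L E] is proper, some nonzero [y] is orthogonal to it; evaluating [a * r] at [y]
    gives a nonzero multiple of [a x]. *)
Let rank1_eq0 a : (forall E x y r, L E ->
  (forall z, lminus L E z -> inner z y = 0) -> E x -> val r = rank1 x y ->
  a * r = 0) -> a = 0.
Proof.
move=> ar0; apply: completely_distributive_eq0 => // E x LE nE Ex.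
have [y y0 yE] := exists_orthogonal (lminus_subspace E) nE.
pose r := MkAlg (rank1_alg LE Ex yE).
have /(congr1 (fun T : Alg L => T y)) := ar0 E x y r LE yE Ex erefl.
rewrite AlgME; change (a (inner y y *: x) = 0 -> a x = 0).
rewrite bop_scale => /eqP; rewrite scaler_eq0 dnorm_eq0 (negPf y0).
by move/eqP.
Qed.

Let rank1_mul a r x y : val r = rank1 x y -> val (a * r) = rank1 (a x) y.
Proof.
move=> rE; apply: bopP => z; change (a (val r z) = inner z y *: a x).
by rewrite rE -bop_scale.
Qed.

(** [d 1] commutes with idempotents, hence with a corner element, a difference of two of them. For
    general [a], [a * r] is again rank one, so [d 1] passes through both [r] and [a * r]. *)
Lemma jordan_at_zero1_central (d : {additive Alg L -> Alg L}) :
  jordan_derivable_at_zero d -> forall a, d 1 * a = a * d 1.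
Proof.
move=> dJ; have rank1C E x y r : L E ->
    (forall z, lminus L E z -> inner z y = 0) -> E x -> val r = rank1 x y ->
    d 1 * r = r * d 1.
  move=> LE yE; move: x r.
  apply: (rank1_ind (P := fun r => d 1 * r = r * d 1) Lcomm LE yE).
  - by move=> r s rC sC; rewrite mulrDl mulrDr rC sC.
  - by move=> c r rC; rewrite -Alg_scalerAr rC Alg_scalerAl.
  - by move=> p [pp _ _]; exact: jordan_at_zero1_commute.
  - move=> p r pp _ pr rp; have rr : r * r = 0 by rewrite -{2}pr mulrA rp mul0r.
    have prI : (p + r) * (p + r) = p + r.
      by rewrite mulrDl !mulrDr pp pr rp rr !addr0.
    have := jordan_at_zero1_commute dJ prI.
    by rewrite mulrDl mulrDr (jordan_at_zero1_commute dJ pp) => /addrI.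
move=> a; apply/eqP; rewrite -subr_eq0; apply/eqP/rank1_eq0.
move=> E x y r LE yE Ex rE.
have rC := rank1C _ _ _ _ LE yE Ex rE.
rewrite mulrBl -!mulrA rC [a * (r * _)]mulrA.
rewrite (rank1C _ _ _ _ LE yE _ (rank1_mul a rE)) ?subrr //.
exact: Alg_invariant.
Qed.

Lemma jordan_unital_derivation (d : {linear Alg L -> Alg L}) :
  d 1 = 0 -> jordan_derivable_at_zero d -> derivation d.
Proof.
move=> d1 dJ; have rank1D E x y r : L E ->
    (forall z, lminus L E z -> inner z y = 0) -> E x -> val r = rank1 x y ->
    forall a, d (a * r) = d a * r + a * d r.
  move=> LE yE; move: x r; pose P r := forall a, d (a * r) = d a * r + a * d r.
  apply: (rank1_ind (P := P) Lcomm LE yE).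
  - move=> r s rD sD a.
    by rewrite !mulrDr !raddfD /= rD sD mulrDr addrACA.
  - move=> c r rD a.
    by rewrite -!Alg_scalerAr !linearZ /= rD scalerDr -!Alg_scalerAr.
  - move=> p [pp pAp p_prime] a; apply: deriv_mul_minimal => // [|b].
      exact: Alg_mulr2n_eq0.
    (* The compression is a scalar multiple of [p], so the rule for [p] itself suffices. *)
    have [c ->] := pAp b; rewrite /= linearZ /= -!Alg_scalerAl -scalerDr.
    by rewrite -deriv_idempotent //; exact: Alg_mulr2n_eq0.
  - move=> p r pp p_inv pr rp a; apply: deriv_mul_corner p_inv _ _ _ _ => //.
    exact: Alg_mulr2n_eq0.
move=> a b; apply/eqP; rewrite -subr_eq0; apply/eqP/rank1_eq0.
move=> E x y r LE yE Ex rE.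
have bxE : E (b x) by exact: Alg_invariant.
(* [d (a * b * r)] is expanded with right factor [r] and with right factor [b * r], which is rank
   one with vector [b x] in [E]. *)
have := rank1D _ _ _ _ LE yE Ex rE (a * b).
rewrite -mulrA (rank1D _ _ _ _ LE yE bxE (rank1_mul b rE)).
rewrite (rank1D _ _ _ _ LE yE Ex rE) => E0.
apply/eqP; rewrite mulrBl subr_eq0 mulrDl; apply/eqP.
by apply: (addIr (a * b * d r)); rewrite -E0 mulrDr !mulrA addrA.
Qed.

End JordanDerivable.

End LatticeAlgebra.

Section NormalizedLinear.
Variables (R : realType) (H : hilbertType R) (L : subspace_lattice H).
Variable d : {linear Alg L -> Alg L}.

(** Supplies the linear structure under which [jordan_unital_derivation] applies to
    [normalized d]. *)
Lemma normalized_scalable : scalable (normalized d).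
Proof.
by move=> c a; rewrite /normalized /= linearZ /= -Alg_scalerAr scalerBr.
Qed.
HB.instance Definition _ := GRing.isScalable.Build R[i] (Alg L) (Alg L) *:%R
  (normalized d) normalized_scalable.

End NormalizedLinear.

Theorem theorem2p9 (R : realType) (H : hilbertType R)
    (L : subspace_lattice H) (delta : {linear Alg L -> Alg L}) :
  separable H -> commutative_lattice L -> completely_distributive L ->
  bounded_map delta ->
  (jordan_derivable_at_zero delta <->
     generalized_derivation delta /\
     commutant (alg_set L) (delta 1 : Alg L)) /\
  (delta 1 = 0 -> (jordan_derivable_at_zero delta <-> derivation delta)).
Proof.
move=> _ Lcomm Lcd _.
have jordanP : jordan_derivable_at_zero delta <->
    generalized_derivation delta /\ commutant (alg_set L) (delta 1 : Alg L).
  split=> [dJ|[dG d1C]].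
    have d1C := jordan_at_zero1_central Lcomm Lcd dJ.
    split=> [|T LT]; last first.
      exact: (congr1 (@alg_op _ _ L) (d1C (MkAlg (mem_set LT)))).
    apply: (generalized_derivation_normalized d1C).
    apply: jordan_unital_derivation => //; first exact: normalized1.
    exact: normalized_jordan.
  apply: generalized_derivation_jordan dG => a.
  by apply: val_inj; apply: d1C; exact: set_mem (valP a).
split=> // d10.
have dGE : generalized_derivation delta <-> derivation delta.
  by split=> dD a b; rewrite dD d10 mulr0 mul0r subr0.
rewrite jordanP dGE; split=> [[]//|dD]; split=> // T _.
by rewrite d10; change (0 * T = T * 0 :> bop H); rewrite mul0r mulr0.
Qed.
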